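(* Let $a,b,c$ be non-negative real numbers with $a+b+c=1$. For each non-negative integer $n$, let $R_n(a,b,c)$ be the random hexagonal cactus with $n$ hexagons, and let $E(m_n(a,b,c))$ denote the expected value of the number of matchings of $R_n(a,b,c)$. Then the generating function $M_{a,b,c}(x)=\sum_{n=0}^{\infty}E(m_n(a,b,c))x^n$ satisfies \[ M_{a,b,c}(x)=\frac{1+10x-3ax-5bx-4cx}{1-8x-3ax-5bx-4cx-26ax^2+10bx^2-8cx^2}. \]
   Context: A matching of a graph is a set of edges no two of which share a vertex (the empty set counts as a matching). A hexagon is a cycle $C_6$. The random hexagonal cactus $R_n(a,b,c)$, for non-negative reals $a,b,c$ with $a+b+c=1$, is defined recursively: $R_0(a,b,c)$ is the empty graph; $R_1(a,b,c)$ is a hexagon; $R_2(a,b,c)$ is obtained from two hexagons by identifying one vertex of one with one vertex of the other. For $n\ge 3$, label the hexagons of $R_{n-1}(a,b,c)$ as $1,\dots,n-1$ consecutively along the chain; the $(n-1)$-th hexagon contains a cut vertex $v$ (shared with the $(n-2)$-th hexagon). Then $R_n(a,b,c)$ is obtained from $R_{n-1}(a,b,c)$ and a new hexagon $H$ by identifying a vertex of $H$ with a vertex of the $(n-1)$-th hexagon that is at distance one from $v$ with probability $a$, at distance two from $v$ with probability $b$, or at distance three from $v$ with probability $c$ (distances measured in the $(n-1)$-th hexagon), independently at each step. *)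

(* Defs.v *)
From HB Require Import structures.
From mathcomp Require Import all_boot all_order all_algebra.
From mathcomp Require Import reals lra.

Set Implicit Arguments.
Unset Strict Implicit.
Unset Printing Implicit Defensive.

Import Order.TTheory GRing.Theory Num.Theory.

(** * Graphs, matchings, distance *)

Record graph := Graph {
  vertex : finType;
  adj : rel vertex;
  adj_sym : symmetric adj;
  adj_irr : irreflexive adj }.

Arguments adj : clear implicits.

Definition edges (G : graph) : {set {set vertex G}} :=
  [set e | [exists x, exists y, adj G x y && (e == [set x; y])]].

Definition is_matching (G : graph) (M : {set {set vertex G}}) : bool :=
  (M \subset edges G) && trivIset M.

Definition nb_matchings (G : graph) : nat :=
  #|[set M : {set {set vertex G}} | is_matching M]|.

(* The length of a shortest walk from x to y; shortest walks have fewer than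
   #|vertex G| steps, and the value is #|vertex G| if y is unreachable. *)
Definition gdist (G : graph) (x y : vertex G) : nat :=
  find (fun k => [exists w : k.-tuple (vertex G),
                    path (adj G) x w && (last x w == y)])
       (iota 0 #|vertex G|).

Definition empty_graph : graph :=
  @Graph void (fun _ _ => false) (fun _ _ => erefl) (fun _ => erefl).

Definition hex_adj : rel 'I_6 := fun i j => (j == ordS i) || (i == ordS j).

Lemma hex_adj_sym : symmetric hex_adj.
Proof. by move=> i j; rewrite /hex_adj orbC. Qed.

Lemma hex_adj_irr : irreflexive hex_adj.
Proof. by case=> [[|[|[|[|[|[|i]]]]]] Hi]. Qed.

Definition hexagon : graph := Graph hex_adj_sym hex_adj_irr.

(** * Hexagonal cactus chains *)

(* A chain together with a cyclic labelling of its last hexagon; once there are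
   at least two hexagons, label 0 is the cut vertex shared with the previous
   one. *)
Record cactus := Cactus {
  cgraph :> graph;
  last_hex : 'I_6 -> vertex cgraph }.

Arguments last_hex : clear implicits.

Section Attach.
Variables (C : cactus) (j : 'I_6).

(* The new hexagon has its vertex 0 identified with the vertex labelled j of the
   last hexagon of C, so it contributes five new vertices. *)
Let V : finType := (vertex C + 'I_5)%type.

Definition new_hex (i : 'I_6) : V :=
  if unlift ord0 i is Some k then inr k else inl (last_hex C j).

Definition old_adj : rel V := fun x y =>
  match x, y with
  | inl u, inl w => adj C u w
  | _, _ => false
  end.

Definition attach_adj : rel V := fun x y =>
  old_adj x y ||
  [exists i, exists k, [&& hex_adj i k, x == new_hex i & y == new_hex k]].

Lemma new_hex_inj : injective new_hex.
Proof.
move=> i k; rewrite /new_hex.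
by case: unliftP => [i' ->|->]; case: unliftP => [k' ->|->] // [->].
Qed.

Lemma attach_adj_sym : symmetric attach_adj.
Proof.
move=> x y; congr orb; first by case: x y => [u|u] [w|w] //=; apply: adj_sym.
by apply/existsP/existsP=> -[i /existsP[k /and3P[ik xi yk]]];
   exists k; apply/existsP; exists i; rewrite hex_adj_sym ik xi yk.
Qed.

Lemma attach_adj_irr : irreflexive attach_adj.
Proof.
move=> x; apply/norP; split; first by case: x => //= u; rewrite adj_irr.
apply/existsP=> -[i /existsP[k /and3P[ik /eqP xi /eqP xk]]].
have ik_eq : i = k by apply: new_hex_inj; rewrite -xi.
by rewrite ik_eq hex_adj_irr in ik.
Qed.

Definition attach : cactus :=
  @Cactus (Graph attach_adj_sym attach_adj_irr) new_hex.

End Attach.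

Definition hexagon_cactus : cactus := @Cactus hexagon id.

(* s lists the labels of the attachment vertices from the third hexagon on. *)
Definition chain (s : seq 'I_6) : cactus :=
  foldl attach (attach hexagon_cactus ord0) s.

Definition cactus_graph (n : nat) (s : (n - 2).-tuple 'I_6) : graph :=
  match n with
  | 0 => empty_graph
  | 1 => hexagon
  | _ => chain s
  end.

Local Open Scope ring_scope.

(** * The random cactus *)

(* p j is the probability that the vertex labelled j of the last hexagon is the
   next attachment vertex. How the mass is divided between two vertices at the
   same distance from the cut vertex (label 0) is left unconstrained. *)
Record attachment_law (R : realType) (a b c : R) (p : 'I_6 -> R) : Prop :=
  AttachmentLaw {
    law_ge0 : forall j, 0 <= p j;
    law_sum : \sum_j p j = 1;
    law_dist1 : \sum_(j | @gdist hexagon ord0 j == 1%N) p j = a;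
    law_dist2 : \sum_(j | @gdist hexagon ord0 j == 2%N) p j = b;
    law_dist3 : \sum_(j | @gdist hexagon ord0 j == 3%N) p j = c }.

Definition expected_matchings (R : realType) (p : 'I_6 -> R) (n : nat) : R :=
  \sum_(s : (n - 2).-tuple 'I_6)
     (\prod_(j <- s) p j) * (nb_matchings (cactus_graph s))%:R.

Lemma gdist_hexagon (j : 'I_6) : @gdist hexagon ord0 j = minn j (6 - j).
Proof.
rewrite /gdist /= card_ord.
pose Q k := [exists w : k.-tuple 'I_6, path hex_adj ord0 w && (last ord0 w == j)].
have Q0 : Q 0%N = (j == ord0).
  apply/existsP/eqP=> [[w]|->]; first by rewrite tuple0 => /eqP.
  by exists [tuple].
have Q1 : Q 1%N = hex_adj ord0 j.
  apply/existsP/idP=> [[w]|h]; last by exists [tuple j]; rewrite /= h eqxx.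
  by case: w => [[|x [|]]] //= _; rewrite andbT => /andP[? /eqP <-].
have Q2 : Q 2%N = [exists x, hex_adj ord0 x && hex_adj x j].
  apply/existsP/existsP=> [[w]|[x /andP[h1 h2]]]; last first.
    by exists [tuple x; j]; rewrite /= h1 h2 eqxx.
  case: w => [[|x [|y [|]]]] //= _; rewrite andbT => /andP[/andP[h1 h2] /eqP <-].
  by exists x; rewrite h1.
rewrite -[find _ _]/(find Q [:: 0; 1; 2; 3; 4; 5]%N) /= Q0 Q1 Q2.
have hexE (x y : 'I_6) :
  hex_adj x y = (val y == x.+1 %% 6)%N || (val x == y.+1 %% 6)%N by [].
have -> : [exists x, hex_adj ord0 x && hex_adj x j] = (val j \in [:: 0; 2; 4]%N).
  apply/existsP/idP=> [[x]|]; rewrite ?hexE.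
    by case: x j {Q Q0 Q1 Q2} =>
      [[|[|[|[|[|[|x]]]]]] Hx] [[|[|[|[|[|[|j]]]]]] Hj].
  case: j {Q Q0 Q1 Q2} => [[|[|[|[|[|[|j]]]]]] Hj] // _;
    by [exists (Ordinal (isT : (1 < 6)%N)) | exists (Ordinal (isT : (5 < 6)%N))].
have Q3 : val j = 3%N -> Q 3%N.
  move=> j3; apply/existsP.
  exists [tuple Ordinal (isT : (1 < 6)%N); Ordinal (isT : (2 < 6)%N); j].
  by rewrite /= !hexE /= j3 eqxx.
move: {Q0 Q1 Q2} Q Q3 => Q.
by case: j => [[|[|[|[|[|[|j]]]]]] Hj] //= ->.
Qed.

(* Attachment laws exist for all admissible a, b, c: e.g. the one that chooses
   uniformly among the vertices at the selected distance. *)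
Lemma attachment_law_exists (R : realType) (a b c : R) :
  0 <= a -> 0 <= b -> 0 <= c -> a + b + c = 1 ->
  attachment_law a b c
    (fun j => nth 0 [:: 0; a / 2; b / 2; c; b / 2; a / 2] j).
Proof.
move=> a0 b0 c0 abc; split.
- by case=> [[|[|[|[|[|[|j]]]]]] Hj] //=; rewrite divr_ge0.
- rewrite !big_ord_recr big_ord0 /= !add0r.
  by lra.
- rewrite big_mkcond !big_ord_recr big_ord0 /= !gdist_hexagon /= /minn /=.
  by rewrite !(add0r, addr0) -splitr.
- rewrite big_mkcond !big_ord_recr big_ord0 /= !gdist_hexagon /= /minn /=.
  by rewrite !(add0r, addr0) -splitr.
- rewrite big_mkcond !big_ord_recr big_ord0 /= !gdist_hexagon /= /minn /=.
  by rewrite !(add0r, addr0).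
Qed.

(** * Formal power series, as coefficient sequences *)

Section FormalPowerSeries.
Variable R : fieldType.

Definition fps : Type := nat -> R.

Definition fps_of_poly (P : {poly R}) : fps := fun n => P`_n.

Definition fps_mul (f g : fps) : fps :=
  fun n => \sum_(i < n.+1) f i * g (n - i)%N.

(* The first n coefficients of 1 / f, obtained from f * (1 / f) = 1. *)
Fixpoint fps_inv_seq (f : fps) (n : nat) : seq R :=
  if n is m.+1 then
    let s := fps_inv_seq f m in
    rcons s (((m == 0%N)%:R - \sum_(i < m) s`_i * f (m - i)%N) / f 0%N)
  else [::].

Definition fps_inv (f : fps) : fps := fun n => (fps_inv_seq f n.+1)`_n.

Definition fps_div (f g : fps) : fps := fps_mul f (fps_inv g).

Lemma size_fps_inv_seq f n : size (fps_inv_seq f n) = n.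
Proof. by elim: n => //= n IHn; rewrite size_rcons IHn. Qed.

Lemma nth_fps_inv_seq f n i : (i < n)%N -> (fps_inv_seq f n)`_i = fps_inv f i.
Proof.
elim: n => // n IHn; rewrite ltnS leq_eqVlt => /predU1P[-> //|lt_in].
by rewrite /= nth_rcons size_fps_inv_seq lt_in IHn.
Qed.

Lemma fps_mulVf (f : fps) :
  f 0%N != 0 -> fps_mul (fps_inv f) f =1 fps_of_poly 1.
Proof.
move=> f0 n; rewrite /fps_mul /fps_of_poly coef1 big_ord_recr /= subnn.
rewrite {2}/fps_inv /= nth_rcons size_fps_inv_seq ltnn eqxx divfK //.
rewrite addrC -[RHS](subrK (\sum_(i < n) fps_inv f i * f (n - i)%N)).
by congr (_ - _ + _); apply: eq_bigr => i _; rewrite nth_fps_inv_seq.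
Qed.

End FormalPowerSeries.

(* Main.v *)
Require Import Defs.
From mathcomp Require Import all_boot all_order all_algebra.
From mathcomp Require Import reals ring lra zify.

(** Gluing a hexagon to a graph [C] at a vertex [w] gives
    [m (C') = 8 m (C) + 10 m (C - w)]: of the 18 matchings of the hexagon, 8
    leave the glued vertex free and 10 cover it. If [C'] is extended in turn at a
    vertex [w'] of the new hexagon, then [m (C' - w')] is likewise
    [alpha m (C) + beta m (C - w)], where [(alpha, beta)] is [(5, 3)], [(3, 5)] or
    [(4, 4)] when [w'] is at distance 1, 2 or 3 from [w]. Eliminating [m (C - w)]
    gives [m (C'') = (8 + beta) m (C') + (10 alpha - 8 beta) m (C)], and averaging
    over [w'] a second-order linear recurrence for the expectations, which
    already holds from the empty graph on. *)

Set Implicit Arguments.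
Unset Strict Implicit.
Unset Printing Implicit Defensive.

Import Order.TTheory GRing.Theory Num.Theory.

(** * Matchings of a coalescence of two graphs *)

(** This is [m (G - v)], expressed inside [G] so that no vertex-deleted graph has to be built. *)
Definition nb_matchings_avoiding (G : graph) (v : vertex G) : nat :=
  #|[set M : {set {set vertex G}} | is_matching M & v \notin cover M]|.

Lemma edgesP (G : graph) (e : {set vertex G}) :
  reflect (exists x y, adj G x y /\ e = [set x; y]) (e \in edges G).
Proof.
rewrite inE; apply: (iffP existsP) => [[x /existsP[y /andP[xy /eqP ->]]]|].
  by exists x, y.
by move=> [x [y [xy ->]]]; exists x; apply/existsP; exists y; rewrite xy eqxx.
Qed.

Lemma adj_neq (G : graph) (x y : vertex G) : adj G x y -> x != y.
Proof. by apply: contraTneq => ->; rewrite adj_irr. Qed.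

Lemma imset_pair (aT rT : finType) (f : aT -> rT) (x y : aT) :
  f @: [set x; y] = [set f x; f y].
Proof. by rewrite imsetU1 imset_set1. Qed.

(* [G] is the union of embedded copies of [G1] and [G2] which meet exactly in
   the image of [w1], identified with that of [w2]. *)
Record coalescence (G1 G2 G : graph) (f1 : vertex G1 -> vertex G)
    (f2 : vertex G2 -> vertex G) (w1 : vertex G1) (w2 : vertex G2) : Prop :=
  Coalescence {
    coal_inj1 : injective f1;
    coal_inj2 : injective f2;
    coal_glue : f1 w1 = f2 w2;
    coal_meet : forall x y, f1 x = f2 y -> x = w1 /\ y = w2;
    coal_edges : edges G = [set f1 @: (e : {set _}) | e in edges G1]
                       :|: [set f2 @: (e : {set _}) | e in edges G2] }.

Lemma coalescence_sym (G1 G2 G : graph) (f1 : vertex G1 -> vertex G)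
    (f2 : vertex G2 -> vertex G) w1 w2 :
  coalescence f1 f2 w1 w2 -> coalescence f2 f1 w2 w1.
Proof.
by case=> ? ? ? meet; split; rewrite 1?setUC // => x y /esym/meet[].
Qed.

(** An edge has two distinct ends, while the two copies share a single vertex. *)
Lemma coalescence_edge_neq (G1 G2 G : graph) (f1 : vertex G1 -> vertex G)
    (f2 : vertex G2 -> vertex G) w1 w2 (e1 : {set vertex G1})
    (e2 : {set vertex G2}) :
  coalescence f1 f2 w1 w2 -> e1 \in edges G1 -> f1 @: e1 != f2 @: e2.
Proof.
move=> gl /edgesP[x [y [xy ->]]]; rewrite imset_pair; apply/eqP => eq12.
have /imsetP[x' _ /(coal_meet gl)[xw _]] : f1 x \in f2 @: e2.
  by rewrite -eq12 set21.
have /imsetP[y' _ /(coal_meet gl)[yw _]] : f1 y \in f2 @: e2.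
  by rewrite -eq12 set22.
by move: (adj_neq xy); rewrite xw yw eqxx.
Qed.

Lemma coalescence_disjoint (G1 G2 G : graph) (f1 : vertex G1 -> vertex G)
    (f2 : vertex G2 -> vertex G) w1 w2 (A : {set vertex G1})
    (B : {set vertex G2}) :
  coalescence f1 f2 w1 w2 ->
  [disjoint f1 @: A & f2 @: B] = ~~ ((w1 \in A) && (w2 \in B)).
Proof.
move=> gl; apply/idP/idP => [dis|].
  apply/andP => -[wA wB]; move/disjoint_setI0/setP/(_ (f1 w1)): dis.
  by rewrite !inE imset_f // (coal_glue gl) imset_f.
apply: contraR => /pred0Pn[_ /andP[/imsetP[x xA ->] /imsetP[y yB]]].
by case/(coal_meet gl) => <- <-; rewrite xA.
Qed.

Definition glue_sets (T1 T2 T : finType) (f1 : T1 -> T) (f2 : T2 -> T)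
    (M1 : {set {set T1}}) (M2 : {set {set T2}}) : {set {set T}} :=
  [set f1 @: (e : {set T1}) | e in M1] :|: [set f2 @: (e : {set T2}) | e in M2].

Definition pull_sets (T1 T : finType) (f1 : T1 -> T) (M : {set {set T}}) :
    {set {set T1}} :=
  [set e : {set T1} | f1 @: e \in M].

Lemma glue_setsC (T1 T2 T : finType) (f1 : T1 -> T) (f2 : T2 -> T) M1 M2 :
  glue_sets f1 f2 M1 M2 = glue_sets f2 f1 M2 M1.
Proof. exact: setUC. Qed.

Lemma cover_imset_imset (T1 T : finType) (f : T1 -> T) (M : {set {set T1}}) :
  cover [set f @: (e : {set T1}) | e in M] = f @: cover M.
Proof. by rewrite cover_imset imset_cover. Qed.

Lemma coverU (T : finType) (P Q : {set {set T}}) :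
  cover (P :|: Q) = cover P :|: cover Q.
Proof. by rewrite /cover bigcup_setU. Qed.

(** An [f1]-image in the glued family cannot come from [M2], whose members are edges of [G2];
    injectivity of [f1] does the rest. *)
Lemma pull_glue_sets1 (G1 G2 G : graph) (f1 : vertex G1 -> vertex G)
    (f2 : vertex G2 -> vertex G) w1 w2 M1 (M2 : {set {set vertex G2}}) :
  coalescence f1 f2 w1 w2 -> M2 \subset edges G2 ->
  pull_sets f1 (glue_sets f1 f2 M1 M2) = M1.
Proof.
move=> gl /subsetP sM2; apply/setP => e; rewrite !inE.
rewrite mem_imset; last exact: imset_inj (coal_inj1 gl).
case: (e \in M1) => //=; apply/imsetP => -[e2 /sM2 e2E /eqP].
by rewrite eq_sym (negPf (coalescence_edge_neq _ (coalescence_sym gl) e2E)).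
Qed.

Lemma pull_glue_sets2 (G1 G2 G : graph) (f1 : vertex G1 -> vertex G)
    (f2 : vertex G2 -> vertex G) w1 w2 (M1 : {set {set vertex G1}}) M2 :
  coalescence f1 f2 w1 w2 -> M1 \subset edges G1 ->
  pull_sets f2 (glue_sets f1 f2 M1 M2) = M2.
Proof.
by move=> /coalescence_sym gl; rewrite glue_setsC; apply: pull_glue_sets1 gl.
Qed.

Lemma mem_edges_coal1 (G1 G2 G : graph) (f1 : vertex G1 -> vertex G)
    (f2 : vertex G2 -> vertex G) w1 w2 (e : {set vertex G1}) :
  coalescence f1 f2 w1 w2 -> (f1 @: e \in edges G) = (e \in edges G1).
Proof.
move=> gl; rewrite (coal_edges gl).
have /setP/(_ e) := pull_glue_sets1 (edges G1) gl (subxx _).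
by rewrite !inE.
Qed.

Lemma glue_pull_sets (G1 G2 G : graph) (f1 : vertex G1 -> vertex G)
    (f2 : vertex G2 -> vertex G) w1 w2 (M : {set {set vertex G}}) :
  coalescence f1 f2 w1 w2 -> M \subset edges G ->
  glue_sets f1 f2 (pull_sets f1 M) (pull_sets f2 M) = M.
Proof.
move=> gl /subsetP sM; apply/setP => e; rewrite inE.
apply/orP/idP => [[]/imsetP[e']|eM]; rewrite ?inE; try by move=> ? ->.
have := sM e eM; rewrite (coal_edges gl) inE => /orP[]/imsetP[e' _ ee'];
  by [left; rewrite ee' imset_f // inE -ee' | right; rewrite ee' imset_f // inE -ee'].
Qed.

Lemma pull_sets_edges (G1 G2 G : graph) (f1 : vertex G1 -> vertex G)
    (f2 : vertex G2 -> vertex G) w1 w2 (M : {set {set vertex G}}) :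
  coalescence f1 f2 w1 w2 -> M \subset edges G ->
  pull_sets f1 M \subset edges G1.
Proof.
move=> gl /subsetP sM; apply/subsetP => e; rewrite [_ \in pull_sets _ _]inE.
by move/sM; rewrite (mem_edges_coal1 _ gl).
Qed.

(** Edges from different sides are never equal, so beyond disjointness on each side the two covers
    must have disjoint images; these can only meet at the glued vertex. *)
Lemma is_matching_glue (G1 G2 G : graph) (f1 : vertex G1 -> vertex G)
    (f2 : vertex G2 -> vertex G) w1 w2
    (M1 : {set {set vertex G1}}) (M2 : {set {set vertex G2}}) :
  coalescence f1 f2 w1 w2 -> M1 \subset edges G1 -> M2 \subset edges G2 ->
  is_matching (glue_sets f1 f2 M1 M2) =
  [&& is_matching M1, is_matching M2
    & ~~ ((w1 \in cover M1) && (w2 \in cover M2))].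
Proof.
move=> gl sM1 sM2; rewrite /is_matching sM1 sM2 /=.
rewrite {1}(coal_edges gl) setUSS ?imsetS //=.
rewrite -(coalescence_disjoint _ _ gl) -!cover_imset_imset.
rewrite -(imset_trivIset M1 (coal_inj1 gl)) -(imset_trivIset M2 (coal_inj2 gl)).
apply/idP/and3P => [tri|[tri1 tri2 dis]]; last exact: trivIsetU.
split; [exact: trivIsetS (subsetUl _ _) tri
  | exact: trivIsetS (subsetUr _ _) tri|].
apply/pred0P => x /=; apply/andP => -[/bigcupP[A AM1 xA] /bigcupP[B BM2 xB]].
have neAB : A != B.
  case/imsetP: AM1 => e1 e1M ->; case/imsetP: BM2 => e2 _ ->.
  exact/(coalescence_edge_neq _ gl)/(subsetP sM1).
have /(_ _ _)/pred0P/(_ x) := trivIsetP tri A B _ _ neAB.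
by rewrite !inE AM1 BM2 orbT /= xA xB; move=> /(_ isT isT).
Qed.

(** Matchings of [G] correspond to pairs of matchings that do not both cover the glued vertex. If
    [M2] leaves [w2] free, [M1] is arbitrary; otherwise [M1] must avoid [w1]. The predicate [P] lets
    one count serve both for all matchings and for those avoiding a further vertex of [G2]. *)
Lemma card_matchings_coalescence (G1 G2 G : graph) (f1 : vertex G1 -> vertex G)
    (f2 : vertex G2 -> vertex G) w1 w2 (P : pred {set {set vertex G2}}) :
  coalescence f1 f2 w1 w2 ->
  #|[set M | is_matching M & P (pull_sets f2 M)]| =
    #|[set M | is_matching M & (w2 \notin cover M) && P M]| * nb_matchings G1
    + #|[set M | is_matching M & (w2 \in cover M) && P M]|
      * nb_matchings_avoiding w1.
Proof.
move=> gl.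
pose A := setX [set M : {set {set vertex G1}} | is_matching M]
   [set M | is_matching M & (w2 \notin cover M) && P M].
pose B := setX [set M | is_matching M & w1 \notin cover M]
   [set M | is_matching M & (w2 \in cover M) && P M].
rewrite mulnC -cardsX [X in _ + X]mulnC -cardsX -/A -/B.
have disAB : A :&: B = set0.
  apply/setP => -[M1 M2]; rewrite !inE /=; apply/negP.
  by case/andP => /and4P[_ _ /negPf-> _] /andP[_ /and3P[]].
have <- : #|A :|: B| = #|A| + #|B| by rewrite cardsU disAB cards0 subn0.
have memAB M1 M2 : ((M1, M2) \in A :|: B) =
    [&& is_matching M1, is_matching M2, P M2
      & ~~ ((w1 \in cover M1) && (w2 \in cover M2))].
  rewrite !inE /=; case: (is_matching M1) => //=; case: (is_matching M2) => //=.
    by case: (w1 \in _); case: (w2 \in _); case: (P M2).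
  by rewrite !andbF.
(* Gluing is injective on the admissible pairs, with pulling back as inverse; it remains to identify
   its image. *)
rewrite -(@card_in_imset _ _ (fun M => glue_sets f1 f2 M.1 M.2) (A :|: B)).
  apply: eq_card => M; rewrite inE; apply/idP/imsetP => [/andP[mM PM]|].
    have /andP[sM _] := mM.
    have E := glue_pull_sets gl sM.
    exists (pull_sets f1 M, pull_sets f2 M); last by rewrite E.
    have s1 := pull_sets_edges gl sM.
    have s2 := pull_sets_edges (coalescence_sym gl) sM.
    move: mM; rewrite memAB PM -{1}E (is_matching_glue gl s1 s2).
    by case/and3P=> -> -> ->.
  move=> [[M1 M2]]; rewrite memAB => /and4P[mM1 mM2 PM2 nw] -> /=.
  have [/andP[sM1 _] /andP[sM2 _]] := (mM1, mM2).
  by rewrite (is_matching_glue gl) // mM1 mM2 nw (pull_glue_sets2 _ gl).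
move=> [M1 M2] [N1 N2]; rewrite !memAB /= => /and4P[/andP[? _] /andP[? _] _ _].
move=> /and4P[/andP[? _] /andP[? _] _ _] E; congr pair.
  by rewrite -(@pull_glue_sets1 _ _ _ _ _ _ _ M1 M2 gl) // E (pull_glue_sets1 _ gl).
by rewrite -(@pull_glue_sets2 _ _ _ _ _ _ _ M1 M2 gl) // E (pull_glue_sets2 _ gl).
Qed.

Lemma nb_matchings_coalescence (G1 G2 G : graph) (f1 : vertex G1 -> vertex G)
    (f2 : vertex G2 -> vertex G) w1 w2 :
  coalescence f1 f2 w1 w2 ->
  nb_matchings G =
    nb_matchings_avoiding w2 * nb_matchings G1
    + #|[set M | is_matching M & w2 \in cover M]| * nb_matchings_avoiding w1.
Proof.
move=> gl.
have -> : nb_matchings G = #|[set M : {set {set vertex G}} |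
                               is_matching M & predT (pull_sets f2 M)]|.
  by apply: eq_card => M; rewrite !inE andbT.
rewrite (card_matchings_coalescence predT gl).
by congr (_ * _ + _ * _); apply: eq_card => M; rewrite !inE andbT.
Qed.

(** As [y] is not the glued vertex, [f2 y] lies outside the copy of [G1], so avoiding it constrains
    only the part in [G2]. *)
Lemma nb_matchings_avoiding_coalescence (G1 G2 G : graph)
    (f1 : vertex G1 -> vertex G) (f2 : vertex G2 -> vertex G) w1 w2 y :
  coalescence f1 f2 w1 w2 -> y != w2 ->
  nb_matchings_avoiding (f2 y) =
    #|[set M | is_matching M & (w2 \notin cover M) && (y \notin cover M)]|
      * nb_matchings G1
    + #|[set M | is_matching M & (w2 \in cover M) && (y \notin cover M)]|
      * nb_matchings_avoiding w1.
Proof.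
move=> gl yw2; rewrite -(card_matchings_coalescence _ gl).
apply: eq_card => M; rewrite !inE.
case: (boolP (is_matching M)) => //= /andP[sM _]; congr (~~ _).
rewrite -{1}(glue_pull_sets gl sM) coverU !cover_imset_imset inE.
rewrite (mem_imset _ _ (coal_inj2 gl)).
suff -> : (f2 y \in f1 @: cover (pull_sets f1 M)) = false by [].
apply/imsetP => -[x _ /esym/(coal_meet gl)[_ yE]].
by rewrite yE eqxx in yw2.
Qed.

(** Only label 0 of the new hexagon is sent to the left summand, so the copies meet there alone. *)
Lemma attach_coalescence (C : cactus) (j : 'I_6) :
  @coalescence C hexagon (attach C j) inl (new_hex C j) (last_hex C j) ord0.
Proof.
split=> //.
- by move=> x y [].
- exact: new_hex_inj.
- by rewrite /new_hex; case: unliftP.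
- by move=> x y; rewrite /new_hex; case: unliftP => // -> [->].
apply/setP => e; rewrite !inE; apply/existsP/orP.
  move=> [x /existsP[y /andP[]]]; rewrite /= /attach_adj => /orP[].
    case: x y => [x|//] [y|//] /= xy /eqP ->.
    left; apply/imsetP; exists [set x; y]; last by rewrite imset_pair.
    by apply/edgesP; exists x, y.
  move=> /existsP[i /existsP[k /and3P[ik /eqP-> /eqP->]]] /eqP ->; right.
  apply/imsetP; exists [set i; k]; last by rewrite imset_pair.
  by apply/(@edgesP hexagon); exists i, k.
move=> [] /imsetP[_ /edgesP[x [y [xy ->]]] ->]; rewrite imset_pair.
  exists (inl x); apply/existsP; exists (inl y); rewrite eqxx andbT.
  by rewrite /= /attach_adj /= xy.
exists (new_hex C j x); apply/existsP; exists (new_hex C j y); rewrite eqxx andbT.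
apply/orP; right; apply/existsP; exists x; apply/existsP; exists y.
by rewrite !eqxx andbT; rewrite /= in xy; rewrite xy.
Qed.

(** * Sums over tuples *)

Lemma big_tuple0 (V : nmodType) (T : finType) (F : seq T -> V) :
  (\sum_(t : 0.-tuple T) F t = F [::])%R.
Proof.
rewrite (big_pred1 [tuple]) // => t.
by apply/esym/eqP/val_inj; case: t => [[]].
Qed.

(** Splits off the last entry, since [chain] grows at the end of its sequence. *)
Lemma big_tuple_rcons (V : nmodType) (T : finType) (n : nat) (F : seq T -> V) :
  (\sum_(t : n.+1.-tuple T) F t =
   \sum_(t : n.-tuple T) \sum_(x : T) F (rcons t x))%R.
Proof.
rewrite pair_big /=.
pose h (u : n.-tuple T * T) : n.+1.-tuple T := [tuple of rcons u.1 u.2].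
rewrite (reindex h) //=; apply: onW_bij.
apply: inj_card_bij => [[t x] [t' x'] /(congr1 val) /= /rcons_inj[tt' ->]|].
  by congr pair; apply: val_inj.
by rewrite card_prod !card_tuple expnSr.
Qed.

(** * Matchings of the hexagon *)

Definition hex_edge (i : 'I_6) : {set 'I_6} := [set i; ordS i].

Lemma ordS_ordS_neq (i : 'I_6) : ordS (ordS i) != i.
Proof. by case: i => [[|[|[|[|[|[|i]]]]]] Hi]. Qed.

Lemma ordS6_inj : injective (@ordS 6).
Proof. exact: can_inj (@ordSK 6). Qed.

(** Two different starting points of one edge would be successors of each other, impossible in a
    cycle of length 6. *)
Lemma hex_edge_inj : injective hex_edge.
Proof.
rewrite /hex_edge => i j E.
have : i \in [set j; ordS j] by rewrite -E set21.
have : ordS i \in [set j; ordS j] by rewrite -E set22.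
rewrite !inE (inj_eq ordS6_inj) => /orP[/eqP Sij|/eqP //] /orP[/eqP //|/eqP iSj].
by have := ordS_ordS_neq i; rewrite Sij -iSj eqxx.
Qed.

Lemma edges_hexagon : edges hexagon = hex_edge @: setT.
Proof.
apply/setP => e; apply/edgesP/imsetP => [[x [y [xy ->]]]|[i _ ->]]; last first.
  by exists i, (ordS i); rewrite /= /hex_adj eqxx.
case/orP: xy => /eqP ->; [exists x | exists y] => //.
by rewrite /hex_edge setUC.
Qed.

(** Edge sets of the hexagon are encoded as 6-bit words, which reduces counting matchings to a
    computation. *)
Definition hex_edges (t : 6.-tuple bool) : {set {set 'I_6}} :=
  hex_edge @: [set i | tnth t i].

Lemma hex_edges_inj : injective hex_edges.
Proof.
move=> s t /(imset_inj hex_edge_inj) /setP E.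
by apply: eq_from_tnth => i; have := E i; rewrite !inE.
Qed.

Lemma cover_hex_edges (t : 6.-tuple bool) (i : 'I_6) :
  (i \in cover (hex_edges t)) = tnth t i || tnth t (ord_pred i).
Proof.
rewrite cover_imset; apply/bigcupP/orP => [[k]|[] ti].
- rewrite !inE => tk /orP[]/eqP->; first by left.
  by right; rewrite ordSK.
- by exists i; rewrite !inE // eqxx.
- by exists (ord_pred i); rewrite !inE // ord_predK eqxx orbT.
Qed.

(** Two distinct edges of the hexagon share a vertex exactly when their indices are cyclically
    consecutive. *)
Lemma is_matching_hex_edges (t : 6.-tuple bool) :
  @is_matching hexagon (hex_edges t) =
  [forall i, tnth t i ==> ~~ tnth t (ordS i)].
Proof.
rewrite /is_matching edges_hexagon imsetS ?subsetT //=.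
apply/trivIsetP/forallP => [tri i|nonadj A B].
  apply/implyP => ti; apply/negP => tSi.
  have neS : hex_edge i != hex_edge (ordS i).
    rewrite (inj_eq hex_edge_inj); apply/eqP => iE.
    by have := ordS_ordS_neq i; rewrite -!iE eqxx.
  have := tri _ _ (imset_f _ _) (imset_f _ _) neS.
  rewrite !inE ti tSi => /(_ isT isT) /pred0P /(_ (ordS i)) /=.
  by rewrite !inE !eqxx orbT.
move=> /imsetP[i]; rewrite inE => ti -> /imsetP[j]; rewrite inE => tj ->.
rewrite (inj_eq hex_edge_inj) => ij; apply/pred0P => x /=; apply/negP.
rewrite !inE => /andP[/orP[]/eqP-> /orP[]].
- exact/negP.
- move/eqP => iE; have := implyP (nonadj j) tj; by rewrite -iE ti.
- move/eqP => iE; have := implyP (nonadj i) ti; by rewrite iE tj.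
- by rewrite (inj_eq ordS6_inj) (negPf ij).
Qed.

Lemma hexagon_matching_surj (M : {set {set 'I_6}}) :
  @is_matching hexagon M -> exists t, M = hex_edges t.
Proof.
case/andP => /subsetP sM _; exists [tuple hex_edge i \in M | i < 6].
apply/setP => e; apply/idP/imsetP => [eM|[i + ->]]; last first.
  by rewrite inE tnth_mktuple.
have := sM e eM; rewrite edges_hexagon => /imsetP[i _ eE].
by exists i; rewrite // inE tnth_mktuple -eE.
Qed.

(** An explicit list of all words, over which counts can be evaluated. *)
Fixpoint bool_seqs (n : nat) : seq (seq bool) :=
  if n is m.+1 then [seq rcons s b | s <- bool_seqs m, b <- [:: true; false]]
  else [:: [::]].

Lemma sum_bool_tuple (n : nat) (F : seq bool -> nat) :
  \sum_(t : n.-tuple bool) F t = sumn (map F (bool_seqs n)).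
Proof.
elim: n F => [|n IHn] F; first by rewrite (@big_tuple0 nat) /= addn0.
rewrite (@big_tuple_rcons nat) /=.
under eq_bigr do rewrite big_bool.
rewrite (IHn (fun s => F (rcons s true) + F (rcons s false))).
elim: (bool_seqs n) => //= s l ->.
by rewrite addnA.
Qed.

Definition hex_nonadj (s : seq bool) : bool :=
  all (fun i => nth false s i ==> ~~ nth false s (i.+1 %% 6)) (iota 0 6).

(** Vertex [i] lies on edge [i] and on the preceding one, whose index is [i + 5] modulo 6. *)
Definition hex_covered (s : seq bool) (i : nat) : bool :=
  nth false s i || nth false s ((i + 5) %% 6).

(** Transfers every count needed for the hexagon to a finite list; [P] selects how vertices [i] and
    [j] are to be covered. *)
Lemma card_hexagon_matchings (i j : 'I_6) (P : rel bool) :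
  #|[set M | @is_matching hexagon M & P (i \in cover M) (j \in cover M)]| =
  count (fun s => hex_nonadj s && P (hex_covered s i) (hex_covered s j))
    (bool_seqs 6).
Proof.
rewrite -sumn_count -sum_bool_tuple.
pose A := [set t : 6.-tuple bool |
  hex_nonadj t && P (hex_covered t i) (hex_covered t j)].
have -> : \sum_(t : 6.-tuple bool)
    (hex_nonadj t && P (hex_covered t i) (hex_covered t j)) = #|A|.
  rewrite -sum1_card [RHS]big_mkcond; apply: eq_bigr => t _; rewrite inE.
  by case: andP.
have nonadjE (t : 6.-tuple bool) :
    hex_nonadj t = @is_matching hexagon (hex_edges t).
  rewrite is_matching_hex_edges /hex_nonadj; apply/allP/forallP => H k.
    by have := H k; rewrite mem_iota /= !(tnth_nth false) => ->.
  rewrite mem_iota /= => lt6.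
  by have := H (Ordinal lt6); rewrite !(tnth_nth false).
have coverE (t : 6.-tuple bool) (k : 'I_6) :
    (k \in cover (hex_edges t)) = hex_covered t k.
  rewrite cover_hex_edges /hex_covered !(tnth_nth false) /=.
  by rewrite addnS.
rewrite -(card_imset _ hex_edges_inj); apply: eq_card => M.
rewrite inE; apply/andP/imsetP => [[mM PM]|[t + ->]].
  have [t tE] := hexagon_matching_surj mM.
  by exists t => //; rewrite inE nonadjE -!coverE -tE mM.
by rewrite inE nonadjE -!coverE => /andP.
Qed.

Lemma nb_matchings_hexagon : nb_matchings hexagon = 18.
Proof.
transitivity #|[set M | @is_matching hexagon M &
  (fun _ _ => true) ((ord0 : 'I_6) \in cover M) ((ord0 : 'I_6) \in cover M)]|.
  by apply: eq_card => M; rewrite !inE andbT.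
by rewrite (card_hexagon_matchings ord0 ord0 (fun _ _ => true)); vm_compute.
Qed.

(** Removing a vertex leaves a path on 5 vertices, which has 8 matchings. *)
Lemma nb_matchings_hexagon_avoiding0 :
  @nb_matchings_avoiding hexagon ord0 = 8.
Proof.
apply: (etrans (card_hexagon_matchings ord0 ord0 (fun x _ => ~~ x))).
by vm_compute.
Qed.

Lemma nb_matchings_hexagon_covering0 :
  #|[set M | @is_matching hexagon M & (ord0 : 'I_6) \in cover M]| = 10.
Proof.
apply: (etrans (card_hexagon_matchings ord0 ord0 (fun x _ => x))).
by vm_compute.
Qed.

(* Number of matchings of the hexagon minus its vertex [j] in which vertex 0 is
   unmatched, resp. matched. *)
Definition path_unmatched (j : nat) : nat := nth 0 [:: 8; 5; 3; 4; 3; 5] j.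
Definition path_matched (j : nat) : nat := nth 0 [:: 0; 3; 5; 4; 5; 3] j.

(** Deleting both 0 and [j] leaves a path on 4 vertices, paths on 1 and 3, or two paths on 2, for
    distance 1, 2 or 3: this gives 5, 3 or [2 * 2] matchings. For [j = 0] the path on 5 vertices
    gives 8. *)
Lemma nb_matchings_path_unmatched (j : 'I_6) :
  #|[set M | @is_matching hexagon M &
     ((ord0 : 'I_6) \notin cover M) && (j \notin cover M)]| = path_unmatched j.
Proof.
apply: (etrans (card_hexagon_matchings ord0 j (fun x y => ~~ x && ~~ y))).
by case: j => [[|[|[|[|[|[|j]]]]]] Hj].
Qed.

(** These values complement those of [path_unmatched] to 8, the number of matchings avoiding [j]. *)
Lemma nb_matchings_path_matched (j : 'I_6) :
  #|[set M | @is_matching hexagon M &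
     ((ord0 : 'I_6) \in cover M) && (j \notin cover M)]| = path_matched j.
Proof.
apply: (etrans (card_hexagon_matchings ord0 j (fun x y => x && ~~ y))).
by case: j => [[|[|[|[|[|[|j]]]]]] Hj].
Qed.

(** * Attaching one and two hexagons *)

Lemma nb_matchings_attach (C : cactus) (j : 'I_6) :
  nb_matchings (attach C j) =
  8 * nb_matchings C + 10 * nb_matchings_avoiding (last_hex C j).
Proof.
rewrite (nb_matchings_coalescence (attach_coalescence C j)).
by rewrite nb_matchings_hexagon_avoiding0 nb_matchings_hexagon_covering0.
Qed.

Lemma nb_matchings_avoiding_attach (C : cactus) (i j : 'I_6) :
  j != ord0 ->
  nb_matchings_avoiding (last_hex (attach C i) j) =
  path_unmatched j * nb_matchings C
  + path_matched j * nb_matchings_avoiding (last_hex C i).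
Proof.
move=> j0; rewrite (nb_matchings_avoiding_coalescence (attach_coalescence C i) j0).
by rewrite nb_matchings_path_unmatched nb_matchings_path_matched.
Qed.

(** Eliminates the avoiding count between the two preceding lemmas; the negative term stands on the
    left because subtraction in [nat] truncates. *)
Lemma nb_matchings_attach2 (C : cactus) (i j : 'I_6) :
  j != ord0 ->
  nb_matchings (attach (attach C i) j) + 8 * path_matched j * nb_matchings C =
  (8 + path_matched j) * nb_matchings (attach C i)
  + 10 * path_unmatched j * nb_matchings C.
Proof.
move=> j0; rewrite nb_matchings_attach nb_matchings_avoiding_attach //.
by rewrite [nb_matchings (attach C i)]nb_matchings_attach; lia.
Qed.

Local Open Scope ring_scope.

(** * Generating functions of second-order recurrences *)

Lemma linear_recurrence2_uniq (R : pzRingType) (d1 d2 : R) (u v : nat -> R) :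
  (forall n, u n.+2 = d1 * u n.+1 + d2 * u n) ->
  (forall n, v n.+2 = d1 * v n.+1 + d2 * v n) ->
  u 0%N = v 0%N -> u 1%N = v 1%N -> u =1 v.
Proof.
move=> hu hv e0 e1 n; suff [] : u n = v n /\ u n.+1 = v n.+1 by [].
by elim: n => // n [en en1]; rewrite hu hv en en1.
Qed.

Lemma fps_inv_quadratic (R : fieldType) (d1 d2 : R) (Q : {poly R}) :
  Q = 1 - d1 *: 'X - d2 *: 'X^2 ->
  let g := fps_inv (fps_of_poly Q) in
  [/\ g 0%N = 1, g 1%N = d1 & forall n, g n.+2 = d1 * g n.+1 + d2 * g n].
Proof.
move=> QE g.
have qE n : fps_of_poly Q n =
    (n == 0)%:R - d1 * (n == 1)%:R - d2 * (n == 2)%:R.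
  by rewrite /fps_of_poly QE !coefE.
have gQ n : \sum_(i < n.+1) g i * fps_of_poly Q (n - i)%N = if n is 0 then 1 else 0.
  rewrite -[LHS]/(fps_mul g (fps_of_poly Q) n) fps_mulVf ?/fps_of_poly ?coef1.
    by case: n.
  by rewrite -/(fps_of_poly Q 0) qE !mulr0 !subr0 oner_neq0.
have g0 : g 0%N = 1.
  by have := gQ 0%N; rewrite big_ord1 qE /= !mulr0 !subr0 mulr1.
have g1 : g 1%N = d1.
  have := gQ 1%N; rewrite !big_ord_recr big_ord0 /= !qE /= g0.
  (* Replacing 0 by the vanishing coefficient [E] turns the goal into a ring identity. *)
  by move=> E; apply/eqP; rewrite -subr_eq0 -E; apply/eqP; ring.
split=> // n; have := gQ n.+2; rewrite !big_ord_recr /=.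
(* [Q] has no coefficient beyond degree 2, so only the last three terms survive. *)
rewrite big1 => [|i _]; last first.
  rewrite qE.
  have -> : (n.+2 - i == 0)%N = false by have := ltn_ord i; lia.
  have -> : (n.+2 - i == 1)%N = false by have := ltn_ord i; lia.
  have -> : (n.+2 - i == 2)%N = false by have := ltn_ord i; lia.
  by rewrite !mulr0 !subr0 mulr0.
have -> : (n.+2 - n = 2)%N by lia.
have -> : (n.+2 - n.+1 = 1)%N by lia.
rewrite subnn !qE /= => E.
by apply/eqP; rewrite -subr_eq0 -E; apply/eqP; ring.
Qed.

(** A numerator of degree at most 1 makes [h n.+1] equal to [g n.+1 + n1 * g n], so [h] inherits the
    recurrence of [1 / Q] from index 0 on. *)
Lemma fps_div_quadratic (R : fieldType) (n1 d1 d2 : R) (P Q : {poly R}) :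
  P = 1 + n1 *: 'X -> Q = 1 - d1 *: 'X - d2 *: 'X^2 ->
  let h := fps_div (fps_of_poly P) (fps_of_poly Q) in
  [/\ h 0%N = 1, h 1%N = n1 + d1 & forall n, h n.+2 = d1 * h n.+1 + d2 * h n].
Proof.
move=> PE QE h.
have [g0 g1 gS] := fps_inv_quadratic QE.
set g := fps_inv _ in g0 g1 gS.
have pE n : fps_of_poly P n = (n == 0)%:R + n1 * (n == 1)%:R.
  by rewrite /fps_of_poly PE !coefE.
have h0 : h 0%N = 1.
  by rewrite /h /fps_div /fps_mul big_ord1 pE -/g g0 /= mulr0 addr0 mulr1.
have hS n : h n.+1 = g n.+1 + n1 * g n.
  rewrite /h /fps_div /fps_mul -/g !big_ord_recl big1 => [|i _]; last first.
    by rewrite pE /= mulr0 addr0 mul0r.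
  by rewrite !pE /= subn0 subSS subn0; ring.
split=> // [|[|n]]; rewrite ?hS ?h0 ?gS ?g0 ?g1; ring.
Qed.

(** * Expected number of matchings *)

Lemma sum_ord6 (V : nmodType) (F : 'I_6 -> V) :
  \sum_j F j = F (inord 0) + F (inord 1) + F (inord 2) + F (inord 3)
               + F (inord 4) + F (inord 5).
Proof.
rewrite !big_ord_recr big_ord0 /= add0r.
by congr (F _ + F _ + F _ + F _ + F _ + F _); apply: val_inj; rewrite /= inordK.
Qed.

(** Labels 0 to 5 are at distances 0, 1, 2, 3, 2, 1 from the cut vertex. If [a], [b], [c] exhaust
    the total mass, nothing is left for label 0. *)
Lemma attachment_lawE (R : realType) (a b c : R) (p : 'I_6 -> R) :
  attachment_law a b c p ->
  [/\ a = p (inord 1) + p (inord 5), b = p (inord 2) + p (inord 4),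
      c = p (inord 3) & a + b + c = 1 -> p (inord 0) = 0].
Proof.
case=> _ + <- <- <-; rewrite !(big_mkcond (fun j => _ == _)) !sum_ord6.
by rewrite !gdist_hexagon !inordK //= => s; split; lra.
Qed.

Lemma nb_matchings_empty : nb_matchings empty_graph = 1%N.
Proof.
rewrite -(cards1 (set0 : {set {set vertex empty_graph}})).
apply: eq_card => M; rewrite !inE /is_matching.
have -> : edges empty_graph = set0.
  by apply/setP => e; rewrite !inE; apply/existsP => -[[]].
rewrite subset0; case: eqP => // ->.
by apply/trivIsetP => A B; rewrite inE.
Qed.

(** Indexing by the number of random choices, two less than the number of hexagons, removes the
    truncated [n - 2]. *)
Definition expected_chain (R : realType) (p : 'I_6 -> R) (n : nat) : R :=
  \sum_(s : n.-tuple 'I_6) (\prod_(j <- s) p j) * (nb_matchings (chain s))%:R.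

Lemma expected_matchings_chain (R : realType) (p : 'I_6 -> R) (n : nat) :
  expected_matchings p n.+2 = expected_chain p n.
Proof.
rewrite /expected_matchings /expected_chain /=.
by have -> : (n.+2 - 2 = n)%N by lia.
Qed.

Lemma chain_rcons (s : seq 'I_6) (j : 'I_6) :
  chain (rcons s j) = attach (chain s) j.
Proof. by rewrite /chain foldl_rcons. Qed.

(* Coefficients of [m (C')] and [m (C)] in the recurrence for [m (C'')], when the
   last hexagon is attached at label [j]. *)
Definition coef_pred (R : pzRingType) (j : 'I_6) : R := 8 + (path_matched j)%:R.

Definition coef_pred2 (R : pzRingType) (j : 'I_6) : R :=
  10 * (path_unmatched j)%:R - 8 * (path_matched j)%:R.

Lemma nb_matchings_attach2_ring (R : comPzRingType) (C : cactus) (i j : 'I_6) :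
  j != ord0 ->
  (nb_matchings (attach (attach C i) j))%:R =
  coef_pred R j * (nb_matchings (attach C i))%:R
  + coef_pred2 R j * (nb_matchings C)%:R.
Proof.
move=> /(nb_matchings_attach2 C i)/(congr1 (fun m : nat => m%:R : R)).
rewrite !(natrD, natrM) /coef_pred /coef_pred2 => E.
by rewrite -[LHS](addrK (8 * (path_matched j)%:R * (nb_matchings C)%:R)) E; ring.
Qed.

(** The linear relation is available for nonzero labels only; label 0 drops out because its weight
    vanishes. *)
Lemma sum_attach2 (R : realType) (p : 'I_6 -> R) (C : cactus) (i : 'I_6) :
  p ord0 = 0 ->
  \sum_j p j * (nb_matchings (attach (attach C i) j))%:R =
  (\sum_j p j * coef_pred R j) * (nb_matchings (attach C i))%:R
  + (\sum_j p j * coef_pred2 R j) * (nb_matchings C)%:R.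
Proof.
move=> p0; rewrite !mulr_suml -big_split /=; apply: eq_bigr => j _.
have [->|j0] := eqVneq j ord0; first by rewrite p0 !mul0r addr0.
by rewrite nb_matchings_attach2_ring // mulrDr !mulrA.
Qed.

Lemma expected_chainS (R : realType) (p : 'I_6 -> R) (n : nat) :
  expected_chain p n.+1 =
  \sum_(s : n.-tuple 'I_6) (\prod_(j <- s) p j) *
     \sum_j p j * (nb_matchings (attach (chain s) j))%:R.
Proof.
rewrite /expected_chain.
rewrite (big_tuple_rcons n (fun s => (\prod_(j <- s) p j) * (nb_matchings (chain s))%:R)).
apply: eq_bigr => s _; rewrite mulr_sumr; apply: eq_bigr => j _.
by rewrite chain_rcons -cats1 big_cat big_seq1 /= mulrA.
Qed.

(** The coefficients depend only on the last label, which is independent of the earlier ones, so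
    their averages factor out. *)
Lemma expected_chain_rec (R : realType) (p : 'I_6 -> R) (n : nat) :
  p ord0 = 0 -> \sum_j p j = 1 ->
  expected_chain p n.+2 =
  (\sum_j p j * coef_pred R j) * expected_chain p n.+1
  + (\sum_j p j * coef_pred2 R j) * expected_chain p n.
Proof.
move=> p0 p1; rewrite [LHS]expected_chainS.
rewrite (big_tuple_rcons n (fun s => (\prod_(j <- s) p j) *
     \sum_j p j * (nb_matchings (attach (chain s) j))%:R)).
rewrite expected_chainS /expected_chain !mulr_sumr -big_split.
apply: eq_bigr => s _; cbv beta.
set P := \prod_(j <- s) p j; set x1 := \sum_j _ * coef_pred _ _.
set x2 := \sum_j _ * coef_pred2 _ _; set m := (nb_matchings (chain s))%:R.
(* The second term depends on the label [i] only through [p i], which sums to 1. *)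
transitivity (\sum_i (x1 * (P * (p i * (nb_matchings (attach (chain s) i))%:R))
                      + x2 * (P * m) * p i)).
  apply: eq_bigr => i _; rewrite chain_rcons sum_attach2 //.
  have -> : \prod_(j <- rcons s i) p j = P * p i.
    by rewrite -cats1 big_cat big_seq1.
  by rewrite -/x1 -/x2 -/m; ring.
by rewrite big_split -!mulr_sumr p1 mulr1.
Qed.

Lemma expected_matchings0 (R : realType) (p : 'I_6 -> R) :
  expected_matchings p 0 = 1.
Proof.
rewrite /expected_matchings (big_pred1 [tuple]) => [|t]; last first.
  by apply/esym/eqP/val_inj; case: t => [[]].
by rewrite big_nil nb_matchings_empty mulr1.
Qed.

Lemma expected_matchings1 (R : realType) (p : 'I_6 -> R) :
  expected_matchings p 1 = 18.
Proof.
rewrite /expected_matchings (big_pred1 [tuple]) => [|t]; last first.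
  by apply/esym/eqP/val_inj; case: t => [[]].
by rewrite big_nil nb_matchings_hexagon mul1r.
Qed.

(** The value is [8 * 18 + 10 * 8], from a hexagon attached to a hexagon. *)
Lemma expected_chain0 (R : realType) (p : 'I_6 -> R) :
  expected_chain p 0 = 224.
Proof.
rewrite /expected_chain (big_tuple0 (fun s => (\prod_(j <- s) p j) *
  (nb_matchings (chain s))%:R)).
rewrite big_nil mul1r -[chain _]/(attach hexagon_cactus ord0) nb_matchings_attach.
by rewrite nb_matchings_hexagon nb_matchings_hexagon_avoiding0.
Qed.

(** The recurrence step reaching back to the single hexagon, which [expected_chain] does not
    include. *)
Lemma expected_chain1 (R : realType) (p : 'I_6 -> R) :
  p ord0 = 0 ->
  expected_chain p 1 =
  (\sum_j p j * coef_pred R j) * 224 + (\sum_j p j * coef_pred2 R j) * 18.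
Proof.
move=> p0.
rewrite expected_chainS (big_tuple0 (fun s => (\prod_(j <- s) p j) *
     \sum_j p j * (nb_matchings (attach (chain s) j))%:R)).
rewrite big_nil mul1r -[chain _]/(attach hexagon_cactus ord0) sum_attach2 //.
by rewrite nb_matchings_attach nb_matchings_hexagon nb_matchings_hexagon_avoiding0.
Qed.

Theorem theorem3 (R : realType) (a b c : R)
    (ha : 0 <= a) (hb : 0 <= b) (hc : 0 <= c) (habc : a + b + c = 1)
    (p : 'I_6 -> R) (hp : attachment_law a b c p) :
  expected_matchings p =1
  fps_div
    (fps_of_poly (1 + 10 *: 'X - (3 * a) *: 'X - (5 * b) *: 'X - (4 * c) *: 'X))
    (fps_of_poly (1 - 8 *: 'X - (3 * a) *: 'X - (5 * b) *: 'X - (4 * c) *: 'X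
                  - (26 * a) *: 'X^2 + (10 * b) *: 'X^2 - (8 * c) *: 'X^2)).
Proof.
(* The denominator is [1 - d1 X - d2 X^2], so both sides should obey the recurrence with
   coefficients [d1] and [d2]. *)
pose d1 := 8 + 3 * a + 5 * b + 4 * c; pose d2 := 26 * a - 10 * b + 8 * c.
have [|| h0 h1 hS] := @fps_div_quadratic R (10 - 3 * a - 5 * b - 4 * c) d1 d2
  (1 + 10 *: 'X - (3 * a) *: 'X - (5 * b) *: 'X - (4 * c) *: 'X)
  (1 - 8 *: 'X - (3 * a) *: 'X - (5 * b) *: 'X - (4 * c) *: 'X
                  - (26 * a) *: 'X^2 + (10 * b) *: 'X^2 - (8 * c) *: 'X^2).
- by rewrite !scalerBl !addrA.
- rewrite /d1 /d2 !(scalerDl, scalerBl, scaleNr) !(opprD, opprK, opprB) !addrA.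
  by [].
have [aE bE cE /(_ habc) p0] := attachment_lawE hp.
have p0' : p ord0 = 0 by rewrite -p0; congr p; apply: val_inj; rewrite /= inordK.
have p1 := law_sum hp.
have e1 : \sum_j p j * coef_pred R j = d1.
  rewrite sum_ord6 /coef_pred /path_matched !inordK //= /d1 p0.
  by move: p1; rewrite sum_ord6 p0; lra.
(* At distances 1, 2, 3 the coefficient is [50 - 24 = 26], [30 - 40 = -10], [40 - 32 = 8]. *)
have e2 : \sum_j p j * coef_pred2 R j = d2.
  rewrite sum_ord6 /coef_pred2 /path_matched /path_unmatched !inordK //= /d2 p0.
  by lra.
apply: (linear_recurrence2_uniq _ hS) => [n||].
- case: n => [|[|n]].
  (* Here [224 = 18 * d1 + d2]: in [18 * (3a + 5b + 4c) + 26a - 10b + 8c] every coefficient is 80,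
     and [a + b + c = 1]. *)
  + rewrite expected_matchings_chain expected_chain0 expected_matchings1.
    by rewrite expected_matchings0 /d1 /d2; lra.
  + rewrite !expected_matchings_chain expected_chain0 expected_matchings1.
    by rewrite expected_chain1 // e1 e2.
  + by rewrite !expected_matchings_chain expected_chain_rec // e1 e2.
- by rewrite h0 expected_matchings0.
- by rewrite h1 expected_matchings1 /d1; ring.
Qed.
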